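(* Let $H=\begin{bmatrix}A&B\\ F&0\end{bmatrix}$ and let $\mathcal G_H$ be its associated graph. Let $n_s$ be the number of sparsity constraints (zero entries) in the feedback matrix $F\in\mathbb R^{m\times n}$. Let $S_k$ denote the set of cycle families of $\mathcal G_H$ of width $k$, $k=1,\dots,n$. Necessary conditions for arbitrary eigenvalue assignment with sparse, static state feedback are: (i) $n_s\le(m-1)n$, that is, $F$ has at least $n$ nonzero entries; (ii) for each $k=1,\dots,n$, there exists a nonzero entry $f_{i_kj_k}$ of $F$ such that its corresponding edge appears in $S_k$.
   Context: $A\in\mathbb R^{n\times n}$, $B\in\mathbb R^{n\times m}$; $F\in\mathbb R^{m\times n}$ has a prescribed sparsity pattern $\bar{\mathsf F}\in\{0,1\}^{m\times n}$: entries with $\bar{\mathsf F}_{ij}=0$ are zero (the ''zero entries''), while entries with $\bar{\mathsf F}_{ij}=1$ are free real parameters (the ''nonzero entries'', treated as symbolic nonzero weights when forming the graph). ''Arbitrary eigenvalue assignment with sparse, static state feedback'' means: for every set $\mathcal S$ of $n$ complex numbers (with multiplicity) closed under complex conjugation, there is a choice of the free entries of $F$ such that the eigenvalues of $A+BF$ are $\mathcal S$; equivalently, all $n$ non-leading coefficients of $\det(sI-A-BF)$ can be assigned arbitrary real values. The graph associated with a square matrix $M=[m_{ij}]$ has one vertex per row/column, and $m_{ij}$ (when nonzero) is the weight of the edge from vertex $j$ to vertex $i$. In $\mathcal G_H$ the first $n$ vertices are state vertices and the last $m$ are control vertices. A cycle is a closed directed path in which no vertex appears more than once except that start and end vertices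 coincide (self-loops are allowed). A cycle family is a set of vertex-disjoint cycles. The width of a cycle family is the total number of state vertices contained in its cycles. An edge appears in $S_k$ if it belongs to some cycle of some cycle family in $S_k$. *)

(* Defs.v *)
From HB Require Import structures.
From mathcomp Require Import all_boot all_order all_algebra.
From mathcomp Require Import reals.
From mathcomp Require Import complex mpoly.

Set Implicit Arguments.
Unset Strict Implicit.
Unset Printing Implicit Defensive.

Import Order.TTheory GRing.Theory Num.Theory.
Local Open Scope ring_scope.

Section Assignment.
Variables (R : realType) (n m : nat).

(* Eigenvalues counted with algebraic multiplicity; S is read as a multiset. *)
Definition eigenvalues_are (M : 'M[R]_n) (S : seq R[i]) : Prop :=
  char_poly (map_mx (real_complex R) M) = \prod_(z <- S) ('X - z%:P).

Definition conj_closed (S : seq R[i]) : bool := perm_eq [seq z^* | z <- S] S.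

(* Entries allowed by the pattern are unconstrained, hence may also vanish. *)
Definition respects_pattern (P : 'M[bool]_(m, n)) (F : 'M[R]_(m, n)) : Prop :=
  forall i j, ~~ P i j -> F i j = 0.

Definition arbitrary_eigenvalue_assignment
    (A : 'M[R]_n) (B : 'M[R]_(n, m)) (P : 'M[bool]_(m, n)) : Prop :=
  forall S : n.-tuple R[i], conj_closed S ->
    exists2 F : 'M[R]_(m, n), respects_pattern P F
                            & eigenvalues_are (A + B *m F) S.

Definition zero_entries (P : 'M[bool]_(m, n)) : {set 'I_m * 'I_n} :=
  [set ij | ~~ P ij.1 ij.2].

Definition nonzero_entries (P : 'M[bool]_(m, n)) : {set 'I_m * 'I_n} :=
  [set ij | P ij.1 ij.2].

(* Each nonzero entry of F is its own indeterminate, i.e. a symbolic nonzero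
   weight. *)
Definition symbolic_F (P : 'M[bool]_(m, n)) : 'M[{mpoly R[m * n]}]_(m, n) :=
  \matrix_(i, j) if P i j then 'X_(mxvec_index i j) else 0.

Definition augmented_mx
    (A : 'M[R]_n) (B : 'M[R]_(n, m)) (P : 'M[bool]_(m, n)) :
    'M[{mpoly R[m * n]}]_(n + m) :=
  block_mx (map_mx (@mpolyC (m * n) R) A) (map_mx (@mpolyC (m * n) R) B)
           (symbolic_F P) 0.

End Assignment.

(* Transposed indices: the entry M i j weights the edge from j to i. *)
Definition mx_graph (K : nmodType) (p : nat) (M : 'M[K]_p) : rel 'I_p :=
  fun j i => M i j != 0.

Section CycleFamilies.
Variable V : finType.
Implicit Types (e : rel V) (c : seq V) (C : seq (seq V)).

(* A cycle is listed by its vertices, without repeating the start vertex; the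
   last vertex has an edge to the first one. A self-loop is a one-vertex list. *)
Definition is_cycle e c : bool := [&& c != [::], cycle e c & uniq c].

Definition is_cycle_family e C : bool :=
  all (is_cycle e) C && pairwise (fun c d => [disjoint c & d]) C.

Definition edge_in_cycle (u v : V) c : bool := (u \in c) && (next c u == v).

End CycleFamilies.

Section Width.
Variables (n m : nat).
Implicit Types (e : rel 'I_(n + m)) (C : seq (seq 'I_(n + m))).

Definition state_vertex (v : 'I_(n + m)) : bool := (v < n)%N.

Definition width C : nat := (\sum_(c <- C) count state_vertex c)%N.

Definition cycle_family_of_width e (k : nat) C : bool :=
  is_cycle_family e C && (width C == k).

Definition edge_appears e (k : nat) (u v : 'I_(n + m)) : Prop :=
  exists2 C, cycle_family_of_width e k C & has (edge_in_cycle u v) C.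

(* The (i, j) entry of F is the weight of the edge from the j-th state vertex to
   the i-th control vertex. *)
Definition feedback_edge_appears e (k : nat) (i : 'I_m) (j : 'I_n) : Prop :=
  edge_appears e k (lshift m j) (rshift n i).

End Width.

(* Main.v *)
(* The non-leading coefficients of the characteristic polynomial of A + B F are
   polynomials in the free entries of F, and assignability makes the resulting
   polynomial map R^N -> R^n surjective. A polynomial map K^N -> K^n with N < n
   is never surjective: if it were, the curve t |-> (t ^ D ^ i)_i would lift
   through it, and expanding exponents in base D would write all powers t ^ a
   with a < D ^ n as linear combinations of fewer than D ^ n monomials in N
   variables, so that a Vandermonde matrix would not have full rank.

   For the graph condition, det (s - A - B F) is the determinant of
   diag (s, ..., s, 1, ..., 1) - H. Expanding it over pairs (permutation s,
   vertex set T with s = id outside T), the terms in degree n - k are those where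
   T contains k state vertices, and a nonzero one is a cycle family of width k.
   If two feedback matrices give different coefficients, some term has an entry
   in which they differ, and that entry is a feedback edge of the family. *)

Require Import Defs.
From HB Require Import structures.
From mathcomp Require Import all_boot all_order all_algebra.
From mathcomp Require Import perm reals.
From mathcomp Require Import complex mpoly.

Set Implicit Arguments.
Unset Strict Implicit.
Unset Printing Implicit Defensive.

Import Order.TTheory GRing.Theory Num.Theory.
Local Open Scope ring_scope.

(** * Polynomial maps that raise dimension *)

Lemma card_bmultinom (n b : nat) : (#|{: 'X_{1..n < b}}| <= b ^ n)%N.
Proof.
have lt_b (mo : 'X_{1..n < b}) i : (mo i < b)%N.
  apply: leq_ltn_trans (bmdeg mo).
  by rewrite mdegE (bigD1 i) //= leq_addr.
pose g (mo : 'X_{1..n < b}) := [ffun i => Ordinal (lt_b mo i)].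
rewrite -[X in (X ^ _)%N]card_ord -[X in (_ ^ X)%N](card_ord n) -card_ffun.
apply: (@leq_card _ _ g) => m1 m2 /ffunP eq_g.
apply/val_inj/mnmP => i.
by have /(congr1 val) := eq_g i; rewrite !ffunE.
Qed.

Section MpolySize.
Variables (R : idomainType) (N : nat).
Implicit Types p q : {mpoly R[N]}.

(** As [msize] is the degree plus one, and 0 for the zero polynomial, a bound by a successor is a
    degree bound that also covers zero. *)
Lemma msizeM_leS p q a b :
  (msize p <= a.+1 -> msize q <= b.+1 -> msize (p * q) <= (a + b).+1)%N.
Proof.
have [-> | p0] := eqVneq p 0; first by rewrite mul0r msize0.
have [-> | q0] := eqVneq q 0; first by rewrite mulr0 msize0.
move=> lepa leqb; rewrite msizeM // -ltnS.
rewrite prednK; last by rewrite addn_gt0 lt0n msize_poly_eq0 p0.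
by apply: leq_trans (leq_add lepa leqb) _; rewrite addSn addnS.
Qed.

Lemma msize_prod_exp (n d : nat) (f : 'I_n -> {mpoly R[N]}) (e : 'I_n -> nat) :
  (forall i, (msize (f i) <= d.+1)%N) ->
  (msize (\prod_i f i ^+ e i) <= (\sum_i e i * d).+1)%N.
Proof.
move=> le_fd.
apply: (big_ind2 (fun p k => msize p <= k.+1)%N); first by rewrite msize1.
  by move=> p a q b; apply: msizeM_leS.
move=> i _; elim: (e i) => [|k IHk]; first by rewrite expr0 msize1.
by rewrite exprS mulSn; apply: msizeM_leS.
Qed.

End MpolySize.

(* Also valid for D = 0, where x %/ 0 = 0 and x %% 0 = x. *)
Lemma sum_digits (D n a : nat) :
  (\sum_(i < n) (a %/ D ^ i %% D) * D ^ i = a %% D ^ n)%N.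
Proof.
elim: n => [|n IHn]; first by rewrite big_ord0 modn1.
rewrite big_ord_recr /= IHn.
have [-> | D_gt0] := posnP D.
  by case: n {IHn} => [|n];
    rewrite ?expn0 ?exp0n // ?muln0 ?addn0 ?divn1 !modn0 ?modn1 ?muln1.
have Dn_gt0 : (0 < D ^ n)%N by rewrite expn_gt0 D_gt0.
set r := (a %/ D ^ n %% D)%N.
have a_eq : a = (a %/ D ^ n %/ D * D ^ n.+1 + (r * D ^ n + a %% D ^ n))%N.
  by rewrite expnS mulnA addnA -mulnDl -divn_eq -divn_eq.
rewrite [in RHS]a_eq modnMDl [LHS]addnC [RHS]modn_small // expnS.
apply: (@leq_trans (r.+1 * D ^ n)).
  by rewrite mulSn addnC ltn_add2r ltn_pmod.
by rewrite leq_mul2r ltn_pmod ?orbT.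
Qed.

Lemma mpoly_surj_leq (K : numFieldType) (n N : nat) (f : 'I_n -> {mpoly K[N]}) :
    (forall y : 'I_n -> K, exists x : 'I_N -> K, forall i, (f i).@[x] = y i) ->
  (n <= N)%N.
Proof.
move=> f_surj; rewrite leqNgt; apply/negP => lt_Nn.
pose d := \max_i msize (f i).
have le_fd i : (msize (f i) <= d.+1)%N by apply/leqW/(leq_bigmax i).
(* Digits are below [D], so [p a] below has degree at most [n * (D * d)], less than [b]; and [D]
   exceeds [k ^ N], so [b ^ N < D ^ N.+1 <= D ^ n]. *)
pose k := (n * d).+1; pose D := (k ^ N).+1; pose b := (k * D)%N.
have lt_bD : (b ^ N < D ^ n)%N.
  rewrite expnMn; apply: (@leq_trans (D ^ N.+1)); last by rewrite leq_pexp2l.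
  by rewrite expnS ltn_mul2r expn_gt0 /=.
pose t (j : 'I_(D ^ n)) : K := (j : nat)%:R.
have [x xP] := fin_all_exists (fun j => f_surj (fun i => t j ^+ (D ^ i))).
pose digit (a : nat) (i : 'I_n) := (a %/ D ^ i %% D)%N.
pose p (a : 'I_(D ^ n)) := \prod_i f i ^+ digit a i.
have p_size a : (msize (p a) <= b)%N.
  apply: leq_trans (msize_prod_exp _ le_fd) _.
  apply: (@leq_ltn_trans (\sum_(i < n) D * d)).
    by apply: leq_sum => i _; rewrite leq_mul2r ltnW ?orbT // ltn_pmod.
  rewrite sum_nat_const card_ord mulnCA mulnC /b /k mulSn.
  by rewrite -[X in (X < _)%N]add0n ltn_add2r.
pose V := Vandermonde (D ^ n) (\row_j t j).
pose r := #|{: 'X_{1..N < b}}|.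
pose C := \matrix_(a < D ^ n, u < r) (p a)@_(enum_val u).
pose M := \matrix_(u < r, j < D ^ n) ('X_[enum_val u] : {mpoly K[N]}).@[x j].
(* Expanding [a] in base [D] shows that [p a] takes the value [t j ^+ a] at [x j]; [C] holds its
   coefficients and [M] the values of the monomials. *)
have defV : V = C *m M.
  apply/matrixP => a j; rewrite !mxE.
  transitivity ((p a).@[x j]).
    rewrite rmorph_prod /= -[in LHS](modn_small (ltn_ord a)) -sum_digits.
    rewrite expr_sum; apply: eq_bigr => i _.
    by rewrite rmorphXn /= xP -exprM mulnC.
  rewrite [in LHS](mpolywE (p_size a)) raddf_sum /=.
  rewrite (reindex _ (onW_bij _ (enum_val_bij _))) /=.
  by apply: eq_bigr => u _; rewrite !mxE mevalZ.
(* The nodes are distinct since the characteristic is zero. *)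
have V_unit : V \in unitmx.
  rewrite unitmxE unitfE det_Vandermonde; apply/prodf_neq0 => i _.
  apply/prodf_neq0 => j lt_ij; rewrite !mxE subr_eq0 eqr_nat.
  by rewrite neq_ltn lt_ij orbT.
have := leq_ltn_trans (leq_trans (rank_leq_col C) (card_bmultinom N b)) lt_bD.
apply/negP; rewrite -leqNgt -[leqLHS](mxrank_unit V_unit) defV.
by rewrite mxrankM_maxl.
Qed.

(** * Cycle families from permutations *)

(** The cycles are the orbits of [s] inside [T], one per root. If [s] sent a point of [T] outside,
    the image would be a fixed point with two preimages, so [T] is a union of orbits. Counting with
    [a] will give the width. *)
Lemma inj_cycle_family (V : finType) (e : rel V) (s : V -> V) (T : {set V}) :
    injective s ->
    (forall v, v \notin T -> s v = v) ->
    (forall v, v \in T -> e v (s v)) ->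
  exists C : seq (seq V),
    [/\ is_cycle_family e C,
        forall a : pred V, (\sum_(c <- C) count a c = #|[set v in T | a v]|)%N
      & forall v, v \in T -> has (edge_in_cycle v (s v)) C].
Proof.
move=> s_inj s_fix s_edge.
have sT : fclosed s (mem T).
  move=> v _ /eqP <-; case: (boolP (v \in T)) => [vT | vNT]; last first.
    by rewrite s_fix // (negPf vNT).
  apply/esym; apply: contraT => svNT.
  by rewrite -(s_inj _ _ (s_fix _ svNT)) (negPf svNT) in vT.
have s_sym := fconnect_sym s_inj.
have orbT x y : x \in T -> y \in orbit s x -> y \in T.
  by move=> xT; rewrite -fconnect_orbit => /(closed_connect sT) <-.
pose r := [seq x <- enum T | x \in froots s].
have r_uniq : uniq r by rewrite filter_uniq ?enum_uniq.
exists [seq orbit s x | x <- r]; split.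
- apply/andP; split.
    apply/allP => _ /mapP[x + ->]; rewrite mem_filter mem_enum => /andP[_ xT].
    rewrite /is_cycle orbit_uniq andbT; apply/andP; split.
      by apply/eqP => o0; have := in_orbit s x; rewrite o0.
    apply: (@sub_in_cycle _ (mem T) (frel s)); last exact: cycle_orbit.
      by move=> u v uT _ /eqP <-; apply: s_edge.
    by apply/allP => y; apply: orbT.
  rewrite pairwise_map.
  move: r_uniq; rewrite uniq_pairwise; apply: sub_in_pairwise (allss r) => x y xr yr /=.
  rewrite !mem_filter in xr yr.
  case/andP: xr => /eqP rx _; case/andP: yr => /eqP ry _.
  apply: contraR => /pred0Pn[z /= /andP[]].
  rewrite -!fconnect_orbit => cxz cyz; rewrite -rx -ry.
  by apply/eqP/(fingraph.rootP s_sym)/(connect_trans cxz); rewrite s_sym.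
- move=> a; rewrite big_map -sum1_card.
  rewrite [RHS](partition_big (froot s) (mem r)) /=; last first.
    move=> v; rewrite inE mem_filter mem_enum => /andP[vT _].
    rewrite inE (roots_root s_sym) /=.
    by rewrite -(closed_connect sT (connect_root _ v)).
  rewrite [LHS]big_uniq //=.
  apply: eq_bigr => x; rewrite mem_filter mem_enum => /andP[/eqP rx xT].
  rewrite -sum1_count big_mkcond [LHS]big_uniq ?orbit_uniq //= -big_mkcondr.
  apply: eq_bigl => v; rewrite !inE -fconnect_orbit s_sym.
  rewrite (sameP (fingraph.rootP s_sym) eqP) rx.
  case: eqP => [rv | _]; last by rewrite andbF.
  rewrite andbT (closed_connect sT (connect_root _ v)) rv xT //.
- move=> v vT; apply/hasP; exists (orbit s (froot s v)).
    apply: map_f; rewrite mem_filter mem_enum inE (roots_root s_sym) /=.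
    by rewrite -(closed_connect sT (connect_root _ v)).
  have vo : v \in orbit s (froot s v).
    by rewrite -fconnect_orbit s_sym connect_root.
  by rewrite /edge_in_cycle vo (nextE (cycle_orbit s_inj _) vo) eqxx.
Qed.

(** * Expansion of the characteristic polynomial *)

(** Schur complement of the lower right identity block: a unitriangular right factor absorbs
    [- F]. *)
Lemma char_poly_feedback (R : comNzRingType) (n m : nat)
    (A : 'M[R]_n) (B : 'M[R]_(n, m)) (F : 'M[R]_(m, n)) :
  char_poly (A + B *m F) =
    \det (block_mx 'X%:M 0 0 1%:M - map_mx polyC (block_mx A B F 0)).
Proof.
rewrite map_block_mx opp_block_mx add_block_mx map_mx0 oppr0 addr0 !add0r.
have -> : block_mx ('X%:M + - map_mx polyC A) (- map_mx polyC B)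
                   (- map_mx polyC F) 1%:M =
    block_mx (char_poly_mx (A + B *m F)) (- map_mx polyC B) 0 1%:M
      *m block_mx 1%:M 0 (- map_mx polyC F) 1%:M.
  rewrite mulmx_block !mulmx0 !mul0mx !mulmx1 !mul1mx !add0r.
  congr block_mx; rewrite /char_poly_mx map_mxD map_mxM mulNmx mulmxN opprK.
  by rewrite opprD addrA subrK.
by rewrite det_mulmx det_ublock det_lblock !det1 !mulr1.
Qed.

Lemma card_state_vertex (n m : nat) (T : {set 'I_(n + m)}) :
  (#|[set v in T | state_vertex v]| + #|[set v in ~: T | state_vertex v]| = n)%N.
Proof.
rewrite -[RHS]card_ord -(card_imset 'I_n (@lshift_inj n m)).
rewrite -(cardsID T [set lshift m x | x in 'I_n]).
have st v : (v \in [set lshift m x | x in 'I_n]) = state_vertex v.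
  apply/imsetP/idP => [[x _ ->] | v_lt]; first exact: (ltn_ord x).
  by exists (Ordinal v_lt); rewrite ?inE //; apply: val_inj.
by congr (_ + _)%N; apply: eq_card => v; rewrite !inE st andbC.
Qed.

(* The contribution of (s, T) to the coefficient of degree k: a vertex outside T
   contributes a diagonal entry, 'X for a state and 1 for a control. *)
Definition det_term (R : nzRingType) (n m : nat) (H : 'M[R]_(n + m)) (k : nat)
    (s : 'S_(n + m)) (T : {set 'I_(n + m)}) : R :=
  if [forall v in ~: T, s v == v] && (#|[set v in ~: T | state_vertex v]| == k)
  then \prod_(v in T) - H (s v) v else 0.

Lemma coef_char_poly_feedback (R : comNzRingType) (n m : nat)
    (A : 'M[R]_n) (B : 'M[R]_(n, m)) (F : 'M[R]_(m, n)) (k : nat) :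
  (char_poly (A + B *m F))`_k =
    \sum_(s : 'S_(n + m)) (-1) ^+ s
       * \sum_(T : {set 'I_(n + m)}) det_term (block_mx A B F 0) k s T.
Proof.
rewrite char_poly_feedback; set H := block_mx A B F 0.
pose D (v : 'I_(n + m)) : {poly R} := if state_vertex v then 'X else 1.
have HE u v : (block_mx 'X%:M 0 0 1%:M - map_mx polyC H) u v =
              (- H u v)%:P + (if u == v then D v else 0).
  rewrite mxE [X in _ + X]mxE [map_mx _ _ u v]mxE polyCN addrC; congr (_ + _).
  rewrite /D /state_vertex.
  case: (split_ordP u) => i ->; case: (split_ordP v) => j ->.
  - by rewrite block_mxEul mxE (inj_eq (@lshift_inj _ _)); case: eqP.
  - by rewrite block_mxEur mxE eq_lrshift.
  - by rewrite block_mxEdl mxE eq_rlshift.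
  - by rewrite block_mxEdr mxE eq_rshift; case: eqP.
(* Transposing turns the factors into entries at [(s v, v)], the weights of edges from [v] to
   [s v]. *)
rewrite -det_tr /determinant coef_sum; apply: eq_bigr => s _.
rewrite -(rmorph_sign polyC) coefCM; congr (_ * _).
under eq_bigr do rewrite mxE HE.
(* [T] is the set of vertices where the constant summand is chosen; elsewhere the diagonal one is,
   which vanishes if [s] moves the vertex. *)
rewrite bigA_distr coef_sum; apply: eq_bigr => T _.
rewrite /det_term (bigID (mem T)) /=.
under eq_bigr => v vT do rewrite vT.
rewrite -rmorph_prod coefCM.
case: forallP => [s_fix | s_nfix] /=; last first.
  have /existsP[v] : [exists v, ~~ ((v \in ~: T) ==> (s v == v))].
    by rewrite -negb_forall; apply/forallP.
  rewrite negb_imply inE => /andP[vT sv].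
  rewrite [X in _ * (polyseq X)`__](_ : _ = 0) ?coef0 ?mulr0 //.
  by rewrite (bigD1 v) //= (negPf vT) (negPf sv) mul0r.
rewrite [X in _ * (polyseq X)`__](_ : _ = 'X^#|[set v in ~: T | state_vertex v]| ); last first.
  rewrite -prodr_const.
  under [in RHS]eq_bigl do rewrite !inE.
  rewrite big_mkcondr; apply: eq_bigr => v vT.
  by have := s_fix v; rewrite inE vT (negPf vT) /= => ->.
by rewrite coefXn eq_sym; case: eqP; rewrite ?mulr1 ?mulr0.
Qed.

(** * The necessary conditions *)

(** The complex roots of the real monic polynomial with coefficients [y] form a conjugation-closed
    multiset, which can be assigned. *)
Lemma assign_coefs (R : realType) (n m : nat)
    (A : 'M[R]_n) (B : 'M[R]_(n, m)) (P : 'M[bool]_(m, n)) (y : 'I_n -> R) :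
  arbitrary_eigenvalue_assignment A B P ->
  exists2 F, respects_pattern P F
           & forall i : 'I_n, (char_poly (A + B *m F))`_i = y i.
Proof.
move=> assign; pose p := 'X^n + rVpoly (\row_i y i).
have size_low : (size (rVpoly (\row_i y i)) < size ('X^n : {poly R}))%N.
  by rewrite size_polyXn ltnS size_poly.
have p_monic : p \is monic by rewrite monicE lead_coefDl // lead_coefXn.
have p_size : size p = n.+1 by rewrite size_polyDl // size_polyXn.
pose pC := map_poly (real_complex R) p.
have [S pC_S] := closed_field_poly_normal pC.
have pC_monic : lead_coef pC = 1.
  by apply/eqP; rewrite -monicE map_monic.
rewrite pC_monic scale1r in pC_S.
have S_size : size S == n.
  by rewrite -eqSS -(size_prod_XsubC S id) -pC_S size_map_poly p_size.
have S_conj : conj_closed (Tuple S_size).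
  apply: prod_XsubC_eq; rewrite /= big_map -pC_S.
  transitivity (map_poly Num.conj pC).
    by rewrite pC_S map_prod_XsubC.
  by apply/polyP => i; rewrite !coef_map /=; exact: conjc_real.
have [F F_P F_eig] := assign _ S_conj; exists F => // i.
have -> : char_poly (A + B *m F) = p.
  apply: (map_poly_inj (real_complex R)).
  by rewrite map_char_poly F_eig /= -pC_S.
by rewrite coefD coefXn (ltn_eqF (ltn_ord i)) add0r coef_rVpoly_ord mxE.
Qed.

Lemma leq_nonzero_entries (R : realType) (n m : nat)
    (A : 'M[R]_n) (B : 'M[R]_(n, m)) (P : 'M[bool]_(m, n)) :
  arbitrary_eigenvalue_assignment A B P -> (n <= #|nonzero_entries P|)%N.
Proof.
move=> assign; set N := #|_|.
pose ent (u : 'I_N) := enum_val u.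
(* Each sum has at most one term: the variable of an allowed entry, or nothing for a forbidden
   one. *)
pose FX := \matrix_(i, j) \sum_(u < N | ent u == (i, j)) ('X_u : {mpoly R[N]}).
pose toX p q (M : 'M_(p, q)) := map_mx (@mpolyC N R) M.
pose f (i : 'I_n) := (char_poly (toX _ _ A + toX _ _ B *m FX))`_i.
apply: (@mpoly_surj_leq _ _ _ f) => y.
have [F F_P F_y] := assign_coefs y assign.
exists (fun u => F (ent u).1 (ent u).2) => i.
rewrite -F_y -coef_map map_char_poly map_mxD map_mxM /=.
set x := fun u => _.
have mapC p q (M : 'M_(p, q)) : map_mx (meval x) (toX _ _ M) = M.
  by apply/matrixP => a b; rewrite !mxE mevalC.
rewrite !mapC; suff -> : map_mx (meval x) FX = F by [].
apply/matrixP => a b; rewrite !mxE raddf_sum /=.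
under eq_bigr do rewrite mevalXU.
have [Pab | nPab] := boolP (P a b); last first.
  rewrite (F_P _ _ nPab) big_pred0 // => u; apply: contraNF nPab => /eqP ent_u.
  by have := enum_valP u; rewrite -/(ent u) ent_u inE.
have ab_in : (a, b) \in nonzero_entries P by rewrite inE.
rewrite (big_pred1 (enum_rank_in ab_in (a, b))) /x /ent ?enum_rankK_in //.
move=> u; rewrite /= -[u in RHS](enum_valK_in ab_in).
by rewrite (inj_in_eq (@enum_rank_in_inj _ _ _ _ ab_in ab_in)) // enum_valP.
Qed.

Lemma feedback_edge_of_coef_neq (R : realType) (n m : nat) (A : 'M[R]_n)
    (B : 'M[R]_(n, m)) (P : 'M[bool]_(m, n)) (F G : 'M[R]_(m, n)) (k : nat) :
    (k <= n)%N -> respects_pattern P F -> respects_pattern P G ->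
    (char_poly (A + B *m F))`_(n - k) != (char_poly (A + B *m G))`_(n - k) ->
  exists i j,
    P i j /\ feedback_edge_appears (mx_graph (augmented_mx A B P)) k i j.
Proof.
move=> le_kn F_P G_P; rewrite !coef_char_poly_feedback => coef_neq.
set H := augmented_mx A B P.
have H0 (K : 'M_(m, n)) u v :
    respects_pattern P K -> H u v = 0 -> block_mx A B K 0 u v = 0.
  move=> K_P; rewrite /H /augmented_mx !mxE; case: splitP => i _; rewrite !mxE.
    by case: splitP => j _; rewrite mxE => /eqP; rewrite mpolyC_eq0 => /eqP.
  case: splitP => j _; rewrite !mxE //.
  case: ifPn => [Pij /eqP | /K_P //].
  by rewrite -msize_poly_eq0 msizeX.
have [s /existsP[T term_neq]] : exists s, [exists T,
    det_term (block_mx A B F 0) (n - k) s T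
      != det_term (block_mx A B G 0) (n - k) s T].
  apply/existsP; apply: contraNT coef_neq => /existsPn term_eq.
  apply/eqP/eq_bigr => s _; congr (_ * _); apply: eq_bigr => T _.
  by have /existsPn/(_ T)/negPn/eqP := term_eq s.
move: term_neq; rewrite /det_term.
case: ifP => [/andP[/forall_inP s_fix /eqP T_width] prod_neq | _]; last first.
  by rewrite eqxx.
(* A missing edge is a zero entry for both [F] and [G], so both products would vanish. *)
have s_edge : forall v, v \in T -> mx_graph H v (s v).
  move=> v vT; apply: contraNneq prod_neq => Hv0.
  by rewrite !(bigD1 v vT) /= !H0 // oppr0 !mul0r.
have [|C [C_fam C_width C_edge]] := inj_cycle_family (@perm_inj _ s) _ s_edge.
  by move=> v vT; apply/eqP/s_fix; rewrite inE.
have /existsP[v /andP[vT Hv_neq]] : [exists v, (v \in T) &&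
    (block_mx A B F 0 (s v) v != block_mx A B G 0 (s v) v)].
  apply: contraNT prod_neq => /existsPn H_eq; apply/eqP/eq_bigr => v vT.
  by have := H_eq v; rewrite vT /= negbK => /eqP ->.
have C_v := C_edge v vT.
(* Only the lower left block depends on the feedback, so [v] is a state and [s v] a control. *)
case: (split_ordP (s v)) Hv_neq => i sv; rewrite sv.
  by case: (split_ordP v) => j ->; rewrite ?block_mxEul ?block_mxEur eqxx.
case: (split_ordP v) => j vj; rewrite vj ?block_mxEdl ?block_mxEdr; last first.
  by rewrite eqxx.
move=> FG; exists i, j; split.
  by apply: contraNT FG => nP; rewrite F_P // G_P.
exists C; last by rewrite -vj -sv.
rewrite /cycle_family_of_width C_fam /width C_width /=.
by rewrite -(eqn_add2r (n - k)) -{1}T_width card_state_vertex subnKC.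
Qed.

Theorem lemma17 (R : realType) (n m : nat)
    (A : 'M[R]_n) (B : 'M[R]_(n, m)) (P : 'M[bool]_(m, n)) :
  arbitrary_eigenvalue_assignment A B P ->
  [/\ #|zero_entries P|%:Z <= (m%:Z - 1) * n%:Z,
      (n <= #|nonzero_entries P|)%N
    & forall k : nat, (1 <= k <= n)%N ->
        exists i j, P i j /\
          feedback_edge_appears (mx_graph (augmented_mx A B P)) k i j].
Proof.
move=> assign; have n_le := leq_nonzero_entries assign; split=> // [|k].
  have : (#|zero_entries P| + #|nonzero_entries P|)%N = (m * n)%N.
    have -> : zero_entries P = ~: nonzero_entries P.
      by apply/setP => ij; rewrite !inE.
    by rewrite addnC cardsC card_prod !card_ord.
  move=> card_eq; rewrite mulrBl mul1r lerBrDr -!natz -natrM -natrD ler_nat.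
  by rewrite -card_eq leq_add2l.
case/andP=> k_gt0 le_kn.
have lt_nk : (n - k < n)%N by rewrite ltn_subrL k_gt0 (leq_trans k_gt0).
(* The targets 0 and 1 differ in degree [n - k], a non-leading one because [k] is positive. *)
have [F F_P F_coef] := assign_coefs (fun=> 0) assign.
have [G G_P G_coef] := assign_coefs (fun=> 1) assign.
apply: (feedback_edge_of_coef_neq le_kn F_P G_P).
have /= -> := F_coef (Ordinal lt_nk); have /= -> := G_coef (Ordinal lt_nk).
by rewrite eq_sym oner_eq0.
Qed.
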